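(* Let $M$ be an $m\times n$ integer matrix and $N=(b_{i,j})$ an $l\times n$ matrix with non-negative integer entries and columns $\mathbf b_1,\dots,\mathbf b_n$ (all columns nonzero), such that $I_N\subseteq I_M$. Let $\phi:K[x_1,\dots,x_n]\to K[t_1,\dots,t_l]$ be the $K$-algebra homomorphism $\phi(x_i)=\mathbf t^{\mathbf b_i}$ (so $I_N=\ker\phi$). Assume $\Gamma(N)=V(I_N)$ in $\bar K^n$. Let $f_1,\dots,f_s\in I_M$ and $J=(f_1,\dots,f_s)$. Then $I_M=\mathrm{rad}(I_N+J)$ if and only if $\mathrm{rad}((\phi(I_M))^e)=\mathrm{rad}(\phi(f_1),\dots,\phi(f_s))$.
   Context: $K$ is a field with algebraic closure $\bar K$. For an integer matrix $M$ with columns $\mathbf a_i\in\mathbb Z^m$ (each nonzero), the toric ideal $I_M\subseteq K[x_1,\dots,x_n]$ is the kernel of $x_i\mapsto \mathbf t^{\mathbf a_i}\in K[t_1^{\pm1},\dots,t_m^{\pm1}]$. $V(I_N)\subseteq\bar K^n$ is the common zero set of $I_N$, and the toric set $\Gamma(N)=\{(\mathbf T^{\mathbf b_1},\dots,\mathbf T^{\mathbf b_n}):\mathbf T=(T_1,\dots,T_l)\in\bar K^l\}$ where $\mathbf T^{\mathbf b_i}=T_1^{b_{1,i}}\cdots T_l^{b_{l,i}}$. $(\phi(I_M))^e$ denotes the ideal $\phi(I_M)K[t_1,\dots,t_l]$. *)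

(* Defs.v *)
From HB Require Import structures.
From mathcomp Require Import all_boot all_order all_algebra.
From mathcomp Require Import mpoly.
Set Implicit Arguments. Unset Strict Implicit. Unset Printing Implicit Defensive.
Import Order.TTheory GRing.Theory Num.Theory.
Local Open Scope ring_scope.

Definition ideal_gen (R : comRingType) (S : R -> Prop) : R -> Prop :=
  fun p => exists gs : seq (R * R),
    (forall x, x \in gs -> S x.2) /\ p = \sum_(x <- gs) x.1 * x.2.

Definition ideal_of_seq (R : comRingType) (fs : seq R) : R -> Prop :=
  ideal_gen (fun p => p \in fs).

Definition ideal_add (R : comRingType) (I J : R -> Prop) : R -> Prop :=
  fun p => exists a b, I a /\ J b /\ p = a + b.

Definition ideal_rad (R : comRingType) (I : R -> Prop) : R -> Prop :=
  fun p => exists k : nat, I (p ^+ k).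

Definition img (A B : Type) (f : A -> B) (S : A -> Prop) : B -> Prop :=
  fun b => exists2 a, S a & b = f a.

(* Toric ideal I_M of an integer matrix M (columns a_i) in K[x_1..x_n]:
   the kernel of x_i |-> t^{a_i} into the Laurent ring K[t^{+-1}].  The image
   of p is  sum_c p_c t^{M c}, whose coefficient at t^u is the sum of the p_c
   over the monomials c with M c = u; so p is in the kernel iff all these
   sums vanish. *)
Definition toric_ideal (K : fieldType) (m n : nat) (M : 'M[int]_(m, n))
  : {mpoly K[n]} -> Prop :=
  fun p => forall u : 'I_m -> int,
    \sum_(c <- msupp p | [forall r : 'I_m, \sum_(i < n) M r i * (c i)%:Z == u r])
       p@_c = 0.

Definition colmon (l n : nat) (N : 'M[nat]_(l, n)) (j : 'I_n) : 'X_{1..l} :=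
  [multinom N k j | k < l].

Definition phiN (K : fieldType) (l n : nat) (N : 'M[nat]_(l, n))
  (p : {mpoly K[n]}) : {mpoly K[l]} :=
  mmap (@mpolyC l K) (fun j => 'X_[colmon N j]) p.

Definition zero_set (K L : fieldType) (iota : {rmorphism K -> L}) (n : nat)
  (I : {mpoly K[n]} -> Prop) : ('I_n -> L) -> Prop :=
  fun x => forall p, I p -> mmap iota x p = 0.

Definition toric_set (L : fieldType) (l n : nat) (N : 'M[nat]_(l, n))
  : ('I_n -> L) -> Prop :=
  fun x => exists T : 'I_l -> L, forall j, x j = \prod_(k < l) T k ^+ N k j.

(* Main.v *)
Require Import Defs.
From HB Require Import structures.
From mathcomp Require Import all_boot all_order all_algebra.
From mathcomp Require Import mpoly zify.
From mathcomp Require classical_sets.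
From Stdlib Require Import Classical.
Set Implicit Arguments.
Unset Strict Implicit.
Unset Printing Implicit Defensive.
Import Order.TTheory GRing.Theory Num.Theory.
Local Open Scope ring_scope.

(* Left to right is formal, since [phi] kills [I_N].  Conversely, a common zero
   of [I_N + J] lies on [Gamma(N)], so it is parametrized by some [T]; the
   [phi(f_i)], and with them every [phi(p)] with [p] in [I_M], vanish at [T].
   Hence every [p] in [I_M] vanishes on [V(I_N + J)] and the Nullstellensatz
   gives [p] in [rad(I_N + J)].  The other inclusion holds because [I_M] is the
   kernel of a map to a field.

   The Nullstellensatz is proved in the form "if no power of [h] lies in [I],
   some zero of [I] in [L^n] is not a zero of [h]", by adjoining one variable
   at a time.  Replace [I] by a prime [P] of [R[X]] containing no power of [h].
   If [P] is not extended from [R], it has an element [g] of least degree with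
   a coefficient outside [P], and [P + (h)] contains a constant [w] outside [P].
   A point of [R] killing the constants of [P] but not [w * lead_coef g]
   extends by any root of [g]: pseudo-division by [g] shows that all of [P]
   vanishes there, so [h], which divides [w] modulo [P], does not. *)

(** * Ideals as predicates, and primes avoiding the powers of an element *)

Definition is_ideal (R : comNzRingType) (I : R -> Prop) : Prop :=
  [/\ I 0, forall a b, I a -> I b -> I (a + b) & forall a b, I b -> I (a * b)].

Lemma is_ideal_ext (R : comNzRingType) (I J : R -> Prop) :
  (forall a, I a <-> J a) -> is_ideal I -> is_ideal J.
Proof.
move=> IJ [I0 ID IM]; split; first exact/IJ.
- by move=> a b /IJ Ia /IJ Ib; apply/IJ/ID.
- by move=> a b /IJ Ib; apply/IJ/IM.
Qed.

Lemma idealB (R : comNzRingType) (I : R -> Prop) (a b : R) :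
  is_ideal I -> I a -> I b -> I (a - b).
Proof. by case=> _ ID IM Ia Ib; rewrite -mulN1r; apply/ID/IM. Qed.

Lemma idealMr (R : comNzRingType) (I : R -> Prop) (a b : R) :
  is_ideal I -> I a -> I (a * b).
Proof. by case=> _ _ IM Ia; rewrite mulrC; apply: IM. Qed.

Lemma is_ideal_add_principal (R : comNzRingType) (I : R -> Prop) (a : R) :
  is_ideal I -> is_ideal (fun x => exists b c, I b /\ x = b + c * a).
Proof.
case=> I0 ID IM; split.
- by exists 0, 0; rewrite mul0r addr0.
- move=> _ _ [b [c [Ib ->]]] [d [e [Id ->]]]; exists (b + d), (c + e).
  by split; [exact: ID | rewrite mulrDl addrACA].
- move=> x _ [b [c [Ib ->]]]; exists (x * b), (x * c).
  by split; [exact: IM | rewrite mulrDr mulrA].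
Qed.

(** Zorn's lemma gives an ideal [P] maximal among those that contain [I] and no power of [h]. It is
    prime: if [a] and [b] lie outside [P], then [P + (a)] and [P + (b)] contain powers of [h], and
    their product lies in [P + (a * b)]. *)
Lemma exists_prime_avoiding (R : comNzRingType) (I : R -> Prop) (h : R) :
    is_ideal I -> (forall k : nat, ~ I (h ^+ k)) ->
  exists P : R -> Prop,
    [/\ is_ideal P, forall a, I a -> P a, forall k : nat, ~ P (h ^+ k)
      & forall a b, P (a * b) -> P a \/ P b].
Proof.
move=> idI Ih; have [I0 ID IM] := idI.
pose good (X : R -> Prop) :=
  is_ideal (fun a => X a \/ I a) /\ forall k : nat, ~ (X (h ^+ k) \/ I (h ^+ k)).
(* Taking unions with [I] makes the empty chain harmless. *)
have [|A [[idA Ah] Amax]] := @classical_sets.Zorn_bigcup R good.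
  move=> F Fgood Ftot; split; first split.
  - by right.
  - move=> a b [[X FX Xa]|Ia] [[Y FY Yb]|Ib].
    + have /= [XY|YX] := Ftot _ _ FX FY.
        have [[_ YD _] _] := Fgood _ FY.
        case: (YD a b (or_introl (XY _ Xa)) (or_introl Yb)) => ?; last by right.
        by left; exists Y.
      have [[_ XD _] _] := Fgood _ FX.
      case: (XD a b (or_introl Xa) (or_introl (YX _ Yb))) => ?; last by right.
      by left; exists X.
    + have [[_ XD _] _] := Fgood _ FX.
      case: (XD a b (or_introl Xa) (or_intror Ib)) => ?; last by right.
      by left; exists X.
    + have [[_ YD _] _] := Fgood _ FY.
      case: (YD a b (or_intror Ia) (or_introl Yb)) => ?; last by right.
      by left; exists Y.
    + by right; apply: ID.
  - move=> a b [[X FX Xb]|Ib]; last by right; apply: IM.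
    have [[_ _ XM] _] := Fgood _ FX.
    case: (XM a b (or_introl Xb)) => ?; last by right.
    by left; exists X.
  - move=> k [[X FX Xh]|]; last exact: Ih.
    by have [_ /(_ k)] := Fgood _ FX; apply; left.
pose P (a : R) := A a \/ I a.
have idP : is_ideal P by [].
have [P0 PD PM] := idP.
have larger a : ~ P a -> exists k : nat, exists b c, P b /\ h ^+ k = b + c * a.
  move=> nPa; apply: NNPP => nk.
  pose B x := exists b c, P b /\ x = b + c * a.
  have PB x : P x -> B x by move=> Px; exists x, 0; rewrite mul0r addr0.
  (* If no power of [h] were in [B], which is [P + (a)], then [B] would be an admissible set
     strictly larger than [A]. *)
  apply: (Amax B).
    split=> [x Ax|BA]; first by apply: PB; left.
    by apply: nPa; left; apply: BA; exists 0, 1; rewrite add0r mul1r.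
  split.
    apply: is_ideal_ext (is_ideal_add_principal a idP) => x.
    by split; [left | case=> // Ix; apply: PB; right].
  move=> k [Bk|Ik]; last exact: Ih Ik.
  by apply: nk; exists k.
exists P; split=> //; first by right.
move=> a b Pab; apply: NNPP => /not_or_and [/larger[i [u [v [Pu ui]]]]].
move=> /larger[j [w [z [Pw wj]]]].
apply: (Ah (i + j)%N); change (P (h ^+ (i + j))).
rewrite exprD ui wj mulrDl mulrDr.
apply: (PD); first by apply: (PD); [apply: idealMr | apply: idealMr].
rewrite mulrDr; apply: (PD); first exact: PM.
by rewrite mulrACA; apply: PM.
Qed.

Lemma prime_ideal_exp (R : comNzRingType) (P : R -> Prop) (a : R) (k : nat) :
  (forall a b, P (a * b) -> P a \/ P b) -> ~ P 1 -> P (a ^+ k) -> P a.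
Proof.
move=> prP P1; elim: k => [|k IHk]; first by rewrite expr0.
by rewrite exprS => /prP[].
Qed.

(** * Elements of least degree relative to a prime ideal of [R[X]] *)

Lemma exists_minimal (T : Type) (S : T -> Prop) (sz : T -> nat) (x : T) :
  S x -> exists y, S y /\ forall z, S z -> (sz y <= sz z)%N.
Proof.
elim: {x}_.+1 {-2}x (ltnSn (sz x)) => // n IHn x; rewrite ltnS => szx Sx.
have [[z [Sz ltzx]]|nz] := classic (exists z, S z /\ (sz z < sz x)%N).
  by apply: IHn Sz; apply: leq_trans ltzx szx.
exists x; split=> // z Sz; rewrite leqNgt; apply/negP => ltzx.
by apply: nz; exists z.
Qed.

Lemma size_sub_lead (R : nzRingType) (f : {poly R}) :
  f != 0 -> (size (f - lead_coef f *: 'X^((size f).-1))%R < size f)%N.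
Proof.
rewrite -size_poly_gt0 => f_gt0; rewrite -[X in (_ < X)%N](prednK f_gt0) ltnS.
apply/leq_sizeP => j le_j; rewrite coefB coefZ coefXn lead_coefE.
case: eqVneq => [->|ne_j]; first by rewrite mulr1 subrr.
rewrite mulr0 subr0 nth_default // -(prednK f_gt0) ltn_neqAle le_j andbT.
by rewrite eq_sym.
Qed.

Lemma ideal_of_coefs (R : comNzRingType) (P : {poly R} -> Prop) (f : {poly R}) :
  is_ideal P -> (forall i, P (f`_i)%:P) -> P f.
Proof.
case=> P0 PD PM Pf; rewrite -[f]coefK poly_def.
elim/big_ind: _ => [||i _]; [exact: P0 | exact: PD |].
by rewrite -mul_polyC mulrC; apply: PM.
Qed.

Section PolyStep.
Variables (R : idomainType) (P : {poly R} -> Prop).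
Hypothesis idP : is_ideal P.
Hypothesis prP : forall a b, P (a * b) -> P a \/ P b.
Hypothesis P1 : ~ P 1.

(** Membership in the ideal of [R[X]] generated by the constants of [P]. *)
Let coefP (f : {poly R}) := forall i, P (f`_i)%:P.

(** Were the leading coefficient in [P], removing the leading term would give a smaller element of
    [S]. *)
Lemma minimal_outside_lead (S : {poly R} -> Prop) g :
    (forall f b, S f -> P b%:P -> S (f - b *: 'X^((size f).-1))) ->
    ~ S 0 -> S g -> (forall f, S f -> (size g <= size f)%N) ->
  ~ P (lead_coef g)%:P.
Proof.
move=> SB S0 Sg ming Pg.
have g0 : g != 0 by apply/eqP => g0; apply: S0; rewrite -g0.
have := ming _ (SB g _ Sg Pg).
by rewrite leqNgt size_sub_lead.
Qed.

Let idealZ b f : P f -> P (b *: f).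
Proof. by case: idP => _ _ PM Pf; rewrite -mul_polyC; apply: PM. Qed.

Let idealZl b f : P b%:P -> P (b *: f).
Proof. by move=> Pb; rewrite -mul_polyC; apply: idealMr. Qed.

Let coefPB f b n : P b%:P -> coefP (f - b *: 'X^n) -> coefP f.
Proof.
move=> Pb Pf i; have := Pf i; rewrite coefB coefZ coefXn => H.
case: idP => _ PD _.
rewrite -[f`_i](subrK (b * (i == n)%:R)) polyCD; apply: PD => //.
by rewrite polyCM; apply: idealMr.
Qed.

(** Take [g] of least size among the elements of [P] that violate [coefP]. If [g] were constant, its
    leading coefficient would be [g] itself and so lie in [P]. *)
Lemma exists_minimal_generator f : P f -> ~ coefP f ->
  exists g, [/\ P g, ~ P (lead_coef g)%:P, (1 < size g)%N
    & forall f, P f -> (size f < size g)%N -> coefP f].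
Proof.
move=> Pf cf.
have [g [[Pg cg] ming]] :=
  @exists_minimal _ (fun f => P f /\ ~ coefP f) (fun f => size f) f (conj Pf cf).
have lg : ~ P (lead_coef g)%:P.
  apply: (@minimal_outside_lead (fun f => P f /\ ~ coefP f)) => //.
  - move=> e b [Pe ce] Pb; split; last by move=> H; apply/ce/coefPB/H.
    by apply: idealB => //; apply: idealZl.
  - by case=> _; apply=> i; rewrite coef0 polyC0; case: idP.
exists g; split=> //.
- rewrite ltnNge; apply/negP => /size1_polyC g1; apply: lg.
  by rewrite g1 lead_coefC -g1.
- move=> e Pe lt_eg; apply: NNPP => ce.
  by have := ming e (conj Pe ce); rewrite leqNgt lt_eg.
Qed.

(* The constant is an element [k] of least degree in [P + (h)] outside [P]:
   otherwise, by pseudo-division, [k] has lower degree than [g] and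
   [c *: g = q * k + r] with [q], [r] in [P] of degree below that of [g]; by
   minimality all their coefficients are in [P], but [lead_coef g] is not. *)
Lemma constant_in_sum g h : P g -> ~ P (lead_coef g)%:P ->
    (forall f, P f -> (size f < size g)%N -> coefP f) -> ~ P h ->
  exists w b e, [/\ ~ P w%:P, P e & w%:P = e + b * h].
Proof.
move=> Pg lg ming Ph.
pose Q x := exists e b, P e /\ x = e + b * h.
have [Q0 QD QM] : is_ideal Q by apply: is_ideal_add_principal.
have PQ x : P x -> Q x by move=> Px; exists x, 0; rewrite mul0r addr0.
have QZ b f : Q f -> Q (b *: f) by move=> Qf; rewrite -mul_polyC; apply: QM.
have [k [[Qk Pk] mink]] : exists k, (Q k /\ ~ P k) /\
    forall f, Q f /\ ~ P f -> (size k <= size f)%N.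
  apply: (@exists_minimal _ (fun f => Q f /\ ~ P f) (fun f => size f) h).
  split=> //; exists 0, 1; rewrite add0r mul1r; split=> //.
  by case: idP.
have lk : ~ P (lead_coef k)%:P.
  apply: (@minimal_outside_lead (fun f => Q f /\ ~ P f)) => //.
  - move=> e b [Qe Pe] Pb; split.
      by apply: idealB; [| | apply/PQ/idealZl].
    move=> H; apply: Pe; rewrite -(subrK (b *: 'X^((size e).-1)) e).
    by case: idP => _ PD _; apply: PD => //; apply: idealZl.
  - by case=> _; apply; case: idP.
have ldX (f : {poly R}) n : ~ P (lead_coef f)%:P -> ~ P (lead_coef f ^+ n)%:P.
  by move=> lf; rewrite polyC_exp => /(prime_ideal_exp prP P1).
have [k1|k_gt1] := leqP (size k) 1.
  have kE := size1_polyC k1; have [e [b [Pe eE]]] := Qk.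
  by exists k`_0, b, e; split; rewrite -?kE.
have k0 : k != 0 by rewrite -size_poly_gt0 ltnW.
have g0 : g != 0.
  by apply/eqP => g0; apply: lg; rewrite g0 lead_coef0 polyC0; case: idP.
exfalso; have [le_gk|lt_kg] := leqP (size g) (size k).
  have /= dE := Pdiv.Idomain.divp_eq k g.
  have rE : k %% g = lead_coef g ^+ scalp k g *: k - k %/ g * g.
    by rewrite dE addrAC subrr add0r.
  have : (size k <= size (k %% g)%R)%N.
    apply: mink; split.
      by rewrite rE; apply: idealB => //; [exact: QZ | apply/PQ; case: idP => _ _; apply].
    move=> Pr; have : P (lead_coef g ^+ scalp k g *: k).
      by rewrite dE; case: (idP) => _ PD PM; apply: (PD) => //; apply: PM.
    by rewrite -mul_polyC => /prP[] //; apply: ldX.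
  by rewrite leqNgt (leq_trans _ le_gk) ?ltn_modpN0.
have /= dE := Pdiv.Idomain.divp_eq g k.
have rE : g %% k = lead_coef k ^+ scalp g k *: g - g %/ k * k.
  by rewrite dE addrAC subrr add0r.
have Pr : P (g %% k).
  apply: NNPP => Pr; have : (size k <= size (g %% k)%R)%N.
    apply: mink; split=> //; rewrite rE; apply: idealB => //.
      by apply/PQ/idealZ.
    exact: QM.
  by rewrite leqNgt ltn_modpN0.
have Pq : P (g %/ k).
  have : P (g %/ k * k).
    have -> : g %/ k * k = lead_coef k ^+ scalp g k *: g - g %% k.
      by rewrite dE addrK.
    by apply: idealB => //; apply: idealZ.
  by case/prP.
have cr : coefP (g %% k).
  by apply: ming => //; apply: ltn_trans lt_kg; apply: ltn_modpN0.
(* The quotient is smaller than [g] because [k] is not constant. *)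
have cq : coefP (g %/ k).
  apply: ming => //; rewrite size_divp // ltn_subrL size_poly_gt0.
  by rewrite g0 andbT -ltnS prednK // ltnW.
(* Compare coefficients in the degree of [g]: those of the quotient and of the remainder all lie in
   [P]. *)
apply: (lg); suff : P (lead_coef k ^+ scalp g k * lead_coef g)%:P.
  by rewrite polyCM => /prP[] // /ldX; case/(_ lk).
rewrite lead_coefE -coefZ dE coefD polyCD.
case: idP => P0 PD PM; apply: (PD); last exact: cr.
rewrite coefM rmorph_sum /=.
elim/big_ind: _ => [||i _]; [exact: P0 | exact: PD |].
by rewrite polyCM mulrC; apply: PM.
Qed.
End PolyStep.

(** * Extending points by one coordinate *)

(** [T] stands for the points of [R] over [L]. The hypothesis is the Nullstellensatz for [R], and
    the conclusion is the same statement for [R[X]], with [y] as the new coordinate. *)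
Lemma poly_points (R : idomainType) (L : closedFieldType) (T : Type)
    (ev : T -> {rmorphism R -> L}) :
    (forall (I : R -> Prop) (h : R), is_ideal I ->
      (forall k : nat, ~ I (h ^+ k)) ->
      exists t, (forall a, I a -> ev t a = 0) /\ ev t h != 0) ->
  forall (I : {poly R} -> Prop) (h : {poly R}), is_ideal I ->
    (forall k : nat, ~ I (h ^+ k)) ->
  exists t y, (forall f, I f -> (map_poly (ev t) f).[y] = 0) /\
    (map_poly (ev t) h).[y] != 0.
Proof.
move=> evP I h idI Ih.
have [P [idP IP Ph prP]] := exists_prime_avoiding idI Ih.
have P1 : ~ P 1 by have := Ph 0%N; rewrite expr0.
have h1 : ~ P h by have := Ph 1%N; rewrite expr1.
have [P0 PD PM] := idP.
have evP' u : ~ P u%:P ->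
    exists t, (forall a, P a%:P -> ev t a = 0) /\ ev t u != 0.
  move=> Pu; apply: (evP (fun a => P a%:P)).
    split=> [|a b Pa Pb|a b Pb]; first by rewrite polyC0.
      by rewrite polyCD; apply: PD.
    by rewrite polyCM; apply: PM.
  by move=> k; rewrite polyC_exp => /(prime_ideal_exp prP P1).
have map0 t (f : {poly R}) : (forall a, P a%:P -> ev t a = 0) ->
    (forall i, P (f`_i)%:P) -> map_poly (ev t) f = 0.
  by move=> t0 cf; apply/polyP => i; rewrite coef_map coef0; apply/t0/cf.
have [[f [Pf cf]]|allc] := classic (exists f, P f /\ ~ forall i, P (f`_i)%:P).
  have [g [Pg lg g_gt1 ming]] := exists_minimal_generator idP Pf cf.
  have [w [b [e [Pw Pe wE]]]] := constant_in_sum idP prP P1 Pg lg ming h1.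
  have [t [t0 tcw]] : exists t, (forall a, P a%:P -> ev t a = 0) /\
      ev t (lead_coef g * w) != 0.
    by apply: evP'; rewrite polyCM => /prP[].
  move: tcw; rewrite rmorphM mulf_eq0 negb_or => /andP[tc tw].
  (* The leading coefficient of [g] survives at [t], so the image of [g] is still nonconstant and
     has a root in [L]. *)
  have /closed_rootP[y gy] : size (map_poly (ev t) g) != 1%N.
    rewrite size_map_poly_id0 // neq_ltn g_gt1 orbT //.
  have root_y f' : P f' -> (map_poly (ev t) f').[y] = 0.
    move=> Pf'; have /= dE := Pdiv.Idomain.divp_eq f' g.
    have g0 : g != 0 by rewrite -size_poly_gt0 ltnW.
    have Pr : P (f' %% g).
      have -> : f' %% g = lead_coef g ^+ scalp f' g *: f' - f' %/ g * g.
        by rewrite dE addrAC subrr add0r.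
      by apply: idealB => //; rewrite -?mul_polyC; apply: PM.
    have := congr1 (fun q => (map_poly (ev t) q).[y]) dE.
    rewrite /= map_polyZ rmorphD rmorphM /= hornerZ hornerD hornerM.
    rewrite (eqP gy) mulr0 (map0 t (f' %% g)) //; last first.
      by apply: ming => //; apply: ltn_modpN0.
    rewrite horner0 addr0 => /eqP; rewrite mulf_eq0 rmorphXn expf_eq0.
    by rewrite (negbTE tc) andbF => /eqP.
  exists t, y; split; first by move=> f' /IP; apply: root_y.
  (* A zero of [h] at this point would make [w = e + b * h] vanish too. *)
  apply: contraNneq tw => hy0.
  have := congr1 (fun q => (map_poly (ev t) q).[y]) wE.
  rewrite /= map_polyC hornerC rmorphD rmorphM /= hornerD hornerM hy0 mulr0.
  by rewrite root_y // addr0 => ->.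
have cP f : P f -> forall i, P (f`_i)%:P.
  by move=> Pf; apply: NNPP => cf; apply: allc; exists f.
(* Here [P] is extended from [R]. At a [t] that kills the constants of [P] but not some coefficient
   of [h], all of [P] maps to 0 and any nonroot of the image of [h] serves as [y]. *)
have [i Phi] : exists i, ~ P (h`_i)%:P.
  by apply: not_all_ex_not => ch; apply: h1; apply: ideal_of_coefs.
have [t [t0 ti]] := evP' _ Phi.
have /closed_nonrootP[y hy] : map_poly (ev t) h != 0.
  by apply: contraNneq ti => h0; rewrite -coef_map h0 coef0.
exists t, y; split=> [f /IP Pf|//].
by rewrite map0 ?horner0 //; apply: cP.
Qed.

(** * Toric ideals as kernels of ring morphisms *)

Lemma mpoly_rmorph_ext (R : comNzRingType) (S : comNzRingType) (n : nat)
    (f g : {rmorphism {mpoly R[n]} -> S}) :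
  (forall c, f c%:MP = g c%:MP) -> (forall i, f 'X_i = g 'X_i) -> f =1 g.
Proof.
move=> fgC fgX p; rewrite [p]mpolyE !rmorph_sum /=; apply: eq_bigr => c _.
rewrite -mul_mpolyC !rmorphM /= fgC; congr (_ * _).
rewrite mpolyXE_id !rmorph_prod; apply: eq_bigr => i _.
by rewrite !rmorphXn /= fgX.
Qed.

(** The target is the fraction field of [K[t]], which contains the Laurent ring and is a domain. *)
Definition laurent_map (K : fieldType) (m n : nat) (M : 'M[int]_(m, n)) :
    {mpoly K[n]} -> {fraction {mpoly K[m]}} :=
  mmap (@tofrac _ \o @mpolyC m K) (fun i => \prod_r (tofrac 'X_r) ^ M r i).

HB.instance Definition _ (K : fieldType) (m n : nat) (M : 'M[int]_(m, n)) :=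
  GRing.RMorphism.copy (@laurent_map K m n M)
    (mmap (@tofrac _ \o @mpolyC m K) (fun i => \prod_r (tofrac 'X_r) ^ M r i)).


(** Up to a monomial factor the image of [p] is a polynomial whose coefficients are the sums in
    [toric_ideal]. *)
Lemma toric_idealE (K : fieldType) (m n : nat) (M : 'M[int]_(m, n))
    (p : {mpoly K[n]}) :
  toric_ideal M p <-> laurent_map M p = 0.
Proof.
pose e (c : 'X_{1..n}) r : int := \sum_(i < n) M r i * (c i)%:Z.
have X0 (r : 'I_m) : tofrac ('X_r : {mpoly K[m]}) != 0.
  by rewrite tofrac_eq0 -msupp_eq0 msuppX.
have lE : laurent_map M p =
    \sum_(c <- msupp p) tofrac (p@_c)%:MP * \prod_r (tofrac 'X_r) ^ e c r.
  rewrite /laurent_map /mmap; apply: eq_bigr => c _; congr (_ * _).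
  transitivity (\prod_i \prod_r (tofrac ('X_r : {mpoly K[m]}) ^ M r i) ^+ c i).
    by apply: eq_bigr => i _; rewrite prodrXl.
  rewrite exchange_big; apply: eq_bigr => r _ /=.
  rewrite /e; elim/big_rec2: _ => [|i x y _ ->]; first by rewrite expr0z.
  by rewrite expfzDr // exprnP exprz_exp.
(* Multiplying by [(prod_r t_r) ^ D] clears the negative exponents. *)
have [D eD] : exists D : nat, forall c r, c \in msupp p -> 0 <= e c r + D%:Z.
  exists (\max_(c <- msupp p) \max_(r < m) `|e c r|%N) => c r cp.
  have : (`|e c r| <= \max_(c <- msupp p) \max_(r < m) `|e c r|)%N.
    apply: leq_trans (leq_bigmax_seq c cp isT).
    exact: leq_bigmax_cond.
  set B := (\max_(_ <- _) _)%N; move: (e c r) => z; lia.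
pose s (c : 'X_{1..n}) := [multinom `|(e c r + D%:Z)%R|%N | r < m].
(* The image of [p] with denominators cleared; its coefficient at [v] sums the [p@_c] with
   [M c = v - D]. *)
pose Q : {mpoly K[m]} := \sum_(c <- msupp p) p@_c *: 'X_[s c].
have sE c v : c \in msupp p ->
  (s c == v) = [forall r, e c r == (v r)%:Z - D%:Z].
  move=> cp; apply/eqP/forallP => [<- r|ev].
    rewrite mnmE gez0_abs ?eD // addrK //.
  apply/mnmP => r; rewrite mnmE (eqP (ev r)) subrK //.
have tQ : tofrac Q = laurent_map M p * \prod_r (tofrac 'X_r) ^+ D.
  rewrite lE rmorph_sum mulr_suml; apply: eq_big_seq => c cp /=.
  rewrite -mul_mpolyC rmorphM -mulrA; congr (_ * _).
  rewrite mpolyXE_id rmorph_prod -big_split; apply: eq_bigr => r _ /=.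
  by rewrite mnmE rmorphXn !exprnP -expfzDr // gez0_abs ?eD.
have QE v : Q@_v = \sum_(c <- msupp p | s c == v) p@_c.
  rewrite /Q raddf_sum [RHS]big_mkcond /=; apply: eq_bigr => c _.
  by rewrite mcoeffZ mcoeffX; case: eqP; rewrite ?mulr1 ?mulr0.
have -> : laurent_map M p = 0 <-> Q = 0.
  split=> [l0|Q0]; first by apply/eqP; rewrite -tofrac_eq0 tQ l0 mul0r.
  have /eqP := tQ; rewrite Q0 rmorph0 eq_sym mulf_eq0 => /orP[/eqP //|].
  by rewrite prodf_seq_eq0 => /hasP[r _]; rewrite expf_eq0 (negbTE (X0 r)) andbF.
split=> [tp|Q0 u].
  apply/mpolyP => v; rewrite mcoeff0 QE -[RHS](tp (fun r => (v r)%:Z - D%:Z)).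
  rewrite big_seq_cond [RHS]big_seq_cond; apply: eq_bigl => c.
  by case cp: (c \in msupp p); rewrite //= sE.
(* If [u] is [M c] for some [c] in the support, its sum is the coefficient of [Q] at [s c];
   otherwise the sum is empty. *)
have [/hasP[c cp cu]|/hasPn nu] :=
  boolP (has (fun c => [forall r, e c r == u r]) (msupp p)).
  rewrite -[RHS](mcoeff0 K (s c)) -Q0 QE.
  rewrite big_seq_cond [RHS]big_seq_cond; apply: eq_bigl => d.
  case dp: (d \in msupp p); rewrite //= sE //; apply: eq_forallb => r.
  by rewrite mnmE gez0_abs ?eD // addrK (eqP (forallP cu r)).
by rewrite big_seq_cond big_pred0 // => c; case cp: (c \in _) => //=; apply/negbTE/nu.
Qed.

HB.instance Definition _ (K : fieldType) (l n : nat) (N : 'M[nat]_(l, n)) :=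
  GRing.RMorphism.copy (@phiN K l n N)
    (mmap (@mpolyC l K) (fun j => 'X_[colmon N j])).

(** * The Nullstellensatz, by induction on the number of variables *)

Lemma mpoly_surj (R : comNzRingType) (S : comNzRingType) (n : nat)
    (f : {rmorphism S -> {mpoly R[n]}}) :
    (forall c, exists s, f s = c%:MP) -> (forall i, exists s, f s = 'X_i) ->
  forall p, exists s, f s = p.
Proof.
move=> fC fX p; rewrite [p]mpolyE; elim/big_ind: _ => [||c _].
- by exists 0; rewrite rmorph0.
- by move=> _ _ [s <-] [t <-]; exists (s + t); rewrite rmorphD.
have [s fs] := fC p@_c; rewrite -mul_mpolyC -fs mpolyXE_id.
suff [t <-] : exists t, f t = \prod_(i < n) 'X_i ^+ c i.
  by exists (s * t); rewrite rmorphM.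
elim/big_ind: _ => [||i _]; first by exists 1; rewrite rmorph1.
  by move=> _ _ [t <-] [u <-]; exists (t * u); rewrite rmorphM.
by have [t <-] := fX i; exists (t ^+ c i); rewrite rmorphXn.
Qed.

Lemma is_ideal_preim (R S : comNzRingType) (f : {rmorphism R -> S})
    (I : S -> Prop) :
  is_ideal I -> is_ideal (fun a => I (f a)).
Proof.
case=> I0 ID IM; split=> [|a b Ia Ib|a b Ib]; first by rewrite rmorph0.
  by rewrite rmorphD; apply: ID.
by rewrite rmorphM; apply: IM.
Qed.

Lemma is_ideal_ker (R S : comNzRingType) (f : {rmorphism R -> S}) :
  is_ideal (fun a => f a = 0).
Proof.
apply: (is_ideal_preim f (I := fun s => s = 0)).
by split=> // [a b -> ->|a b ->]; rewrite ?addr0 ?mulr0.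
Qed.

Lemma nullstellensatz (K : fieldType) (L : closedFieldType)
    (iota : {rmorphism K -> L}) (n : nat) (I : {mpoly K[n]} -> Prop)
    (h : {mpoly K[n]}) :
    is_ideal I -> (forall k : nat, ~ I (h ^+ k)) ->
  exists x, zero_set iota I x /\ mmap iota x h != 0.
Proof.
elim: n I h => [|n IHn] I h idI Ih.
  have [I0 ID IM] := idI.
  (* Without variables every polynomial is constant: [h] is nonzero, and a nonzero constant in [I]
     would put [1 = h ^+ 0] in [I]. *)
  exists (fun=> 0); split=> [p Ip|]; last first.
    have := Ih 1%N; rewrite expr1 (nvar0_mpolyC h) mmapC fmorph_eq0.
    by case: eqP => // ->; rewrite mpolyC0.
  have := Ih 0%N; rewrite expr0; move: Ip; rewrite (nvar0_mpolyC p) mmapC.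
  move: (p@_0) => c Ic; have [->|c0] := eqVneq c 0; first by move=> _; apply: rmorph0.
  by case; rewrite -mpolyC1 -(mulVf c0) mpolyCM; apply: IM.
pose ev (a : 'I_n -> L) : {rmorphism {mpoly K[n]} -> L} := mmap iota a.
(* [sigma] puts the last variable for [X]. Being surjective, it lets [I] and [h] be pulled back to
   [K[x_1..x_n][X]]. *)
pose sigma : {rmorphism {poly {mpoly K[n]}} -> {mpoly K[n.+1]}} :=
  horner_eval ('X_ord_max : {mpoly K[n.+1]}) \o map_poly (@mwiden n K).
have surj : forall p, exists F, sigma F = p.
  apply: mpoly_surj => [c|i].
    by exists (c%:MP)%:P; rewrite /= map_polyC /horner_eval hornerC /= mwidenC.
  have [j ->|->] := unliftP ord_max i; last first.
    by exists 'X; rewrite /= map_polyX /horner_eval hornerX.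
  exists ('X_j)%:P; rewrite /= map_polyC /horner_eval hornerC /= mwidenX mnmwiden1.
  by congr 'X_[U_(_)]; apply: val_inj; rewrite /= /bump leqNgt ltn_ord.
have [F FE] := surj h.
have [a [y [Ia hy]]] : exists a y,
    (forall f, I (sigma f) -> (map_poly (ev a) f).[y] = 0) /\
    (map_poly (ev a) F).[y] != 0.
  apply: (@poly_points _ _ _ ev) => [J g idJ gJ||k].
  - exact: IHn.
  - exact: is_ideal_preim.
  - by rewrite rmorphXn FE.
pose x i := if unlift ord_max i is Some j then a j else y.
have xE f : mmap iota x (sigma f) = (map_poly (ev a) f).[y].
  rewrite /= /horner_eval -horner_map /= mmapX mmap1U /x unlift_none -map_poly_comp.
  congr _.[_]; apply: eq_map_poly => /= p.
  apply: (mpoly_rmorph_ext (f := mmap iota x \o @mwiden n K) (g := ev a)) => [c|i] /=.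
    by rewrite mwidenC /ev !mmapC.
  rewrite mwidenX mnmwiden1 /ev !mmapX !mmap1U.
  have -> : widen_ord (leqnSn n) i = lift ord_max i.
    by apply: val_inj; rewrite /= /bump leqNgt ltn_ord.
  by rewrite /x liftK.
exists x; split=> [p Ip|]; last by rewrite -FE xE.
have [f fE] := surj p.
by rewrite -fE xE; apply: Ia; rewrite fE.
Qed.

(** * Toric ideals under [phiN] and under evaluation *)

Lemma is_ideal_toric (K : fieldType) (m n : nat) (M : 'M[int]_(m, n)) :
  is_ideal (toric_ideal (K := K) M).
Proof.
apply: is_ideal_ext (is_ideal_ker (laurent_map (K := K) M)) => p.
by split=> /toric_idealE.
Qed.

Lemma toric_ideal_radical (K : fieldType) (m n : nat) (M : 'M[int]_(m, n))
    (p : {mpoly K[n]}) (k : nat) :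
  toric_ideal M (p ^+ k) -> toric_ideal M p.
Proof.
by move=> /toric_idealE/eqP; rewrite rmorphXn expf_eq0 => /andP[_ /eqP/toric_idealE].
Qed.

(** The Laurent map of [N] is [phiN N] followed by the injection [tofrac]. *)
Lemma phiN_toric (K : fieldType) (l n : nat) (N : 'M[nat]_(l, n))
    (p : {mpoly K[n]}) :
  toric_ideal (map_mx Posz N) p <-> phiN N p = 0.
Proof.
have pE : laurent_map (map_mx Posz N) p = tofrac (phiN N p).
  apply: (mpoly_rmorph_ext (f := laurent_map (map_mx Posz N))
           (g := @tofrac _ \o phiN N)) => [c|i] /=.
    by rewrite /laurent_map /phiN !mmapC.
  rewrite /laurent_map /phiN !mmapX !mmap1U mpolyXE_id rmorph_prod.
  by apply: eq_bigr => r _; rewrite rmorphXn mnmE mxE.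
rewrite toric_idealE pE; split=> [/eqP|->]; last exact: rmorph0.
by rewrite tofrac_eq0 => /eqP.
Qed.

(** [phiN] is composition with the parametrization of [x] by [T]. *)
Lemma mmap_phiN (K L : fieldType) (iota : {rmorphism K -> L}) (l n : nat)
    (N : 'M[nat]_(l, n)) (T : 'I_l -> L) (x : 'I_n -> L) (p : {mpoly K[n]}) :
    (forall j, x j = \prod_(k < l) T k ^+ N k j) ->
  mmap iota x p = mmap iota T (phiN N p).
Proof.
move=> xT; apply: (mpoly_rmorph_ext (f := mmap iota x)
                     (g := mmap iota T \o phiN N)) => [c|j] /=.
  by rewrite /phiN !mmapC.
rewrite /phiN !mmapX !mmap1U mmapX xT /mmap1.
by apply: eq_bigr => k _; rewrite mnmE.
Qed.

(** * Generated ideals, sums and radicals *)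

Lemma is_ideal_gen (R : comNzRingType) (S : R -> Prop) : is_ideal (ideal_gen S).
Proof.
split.
- by exists [::]; split=> //; rewrite big_nil.
- move=> _ _ [s [sS ->]] [t [tS ->]]; exists (s ++ t); split; last by rewrite big_cat.
  by move=> x; rewrite mem_cat => /orP[/sS|/tS].
- move=> a _ [s [sS ->]]; exists [seq (a * x.1, x.2) | x <- s]; split.
    by move=> _ /mapP[x xs ->] /=; apply: sS.
  by rewrite big_map mulr_sumr; apply: eq_bigr => x _; rewrite mulrA.
Qed.

Lemma sub_ideal_gen (R : comNzRingType) (S : R -> Prop) (a : R) :
  S a -> ideal_gen S a.
Proof.
move=> Sa; exists [:: (1, a)]; split; last by rewrite big_seq1 mul1r.
by move=> x; rewrite inE => /eqP ->.
Qed.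

Lemma ideal_gen_min (R : comNzRingType) (S I : R -> Prop) :
  is_ideal I -> (forall a, S a -> I a) -> forall a, ideal_gen S a -> I a.
Proof.
case=> I0 ID IM SI _ [s [sS ->]]; rewrite big_seq.
by elim/big_ind: _ => // x /sS/SI; apply: IM.
Qed.

Lemma is_ideal_add (R : comNzRingType) (I J : R -> Prop) :
  is_ideal I -> is_ideal J -> is_ideal (ideal_add I J).
Proof.
move=> [I0 ID IM] [J0 JD JM]; split.
- by exists 0, 0; rewrite addr0.
- move=> _ _ [a [b [Ia [Jb ->]]]] [c [d [Ic [Jd ->]]]].
  by exists (a + c), (b + d); rewrite addrACA; split; [apply: ID | split; first apply: JD].
- move=> c _ [a [b [Ia [Jb ->]]]]; exists (c * a), (c * b).
  by rewrite mulrDr; split; [apply: IM | split; first apply: JM].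
Qed.

(** Primes replace the expansion of powers of sums: a prime containing [I] contains every [s] in
    [S], hence a power of [a], so it cannot avoid them all. *)
Lemma ideal_gen_rad (R : comNzRingType) (S I : R -> Prop) (a : R) :
    is_ideal I -> (forall s, S s -> ideal_rad I s) ->
  ideal_rad (ideal_gen S) a -> ideal_rad I a.
Proof.
move=> idI SI [j Saj]; apply: NNPP => Ia.
have [|P [idP IP Pa prP]] := exists_prime_avoiding (h := a) idI.
  by move=> k Iak; apply: Ia; exists k.
apply: (Pa j); apply: (ideal_gen_min idP _ Saj) => s /SI[k /IP].
by apply: prime_ideal_exp => // P1; apply: (Pa 0%N); rewrite expr0.
Qed.

(** * The equivalence of the two radical equalities *)

Theorem theorem3p1
  (K : fieldType) (L : closedFieldType) (iota : {rmorphism K -> L})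
  (Lalg : forall z : L, algebraicOver iota z)
  (m n l : nat) (M : 'M[int]_(m, n)) (N : 'M[nat]_(l, n))
  (HMcol : forall j : 'I_n, exists r : 'I_m, M r j != 0)
  (HNcol : forall j : 'I_n, exists k : 'I_l, N k j != 0%N)
  (HNM : forall p, toric_ideal (map_mx Posz N) p -> toric_ideal (K := K) M p)
  (Hgamma : forall x : 'I_n -> L,
      toric_set N x <-> zero_set iota (toric_ideal (K := K) (map_mx Posz N)) x)
  (fs : seq {mpoly K[n]})
  (Hfs : forall f, f \in fs -> toric_ideal M f) :
  (forall p, toric_ideal (K := K) M p <->
     ideal_rad (ideal_add (toric_ideal (map_mx Posz N)) (ideal_of_seq fs)) p)
  <->
  (forall q, ideal_rad (ideal_gen (img (phiN N) (toric_ideal M))) q <->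
     ideal_rad (ideal_of_seq (map (phiN N) fs)) q).
Proof.
split=> [radM q|radphi p]; split.
- apply: ideal_gen_rad; first exact: is_ideal_gen.
  (* From [p ^+ k = a + b] with [a] killed by [phiN], the power of [phiN N p] is [phiN N b], a
     combination of the images of [fs]. *)
  move=> _ [p /radM[k [a [b [/phiN_toric a0 [Jb pE]]]]] ->]; exists k.
  rewrite -rmorphXn pE rmorphD /= a0 add0r.
  apply: (ideal_gen_min (is_ideal_preim (phiN N) (is_ideal_gen _)) _ Jb) => f ffs.
  by apply: sub_ideal_gen; apply: map_f.
- apply: ideal_gen_rad; first exact: is_ideal_gen.
  move=> _ /mapP[f /Hfs Mf ->]; exists 1%N; rewrite expr1; apply: sub_ideal_gen.
  by exists f.
- move=> Mp; apply: NNPP => radp.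
  have idIJ : is_ideal (ideal_add (toric_ideal (map_mx Posz N)) (ideal_of_seq fs)).
    by apply: is_ideal_add; [apply: is_ideal_toric | apply: is_ideal_gen].
  have [|x [x0]] := nullstellensatz iota (h := p) idIJ.
    by move=> k pk; apply: radp; exists k.
  have /Hgamma[T xT] : zero_set iota (toric_ideal (map_mx Posz N)) x.
    move=> f Nf; apply: x0; exists f, 0; rewrite addr0; split=> //.
    by split=> //; case: (is_ideal_gen (fun f => f \in fs)).
  have [|k pk] := (radphi (phiN N p)).1.
    by exists 1%N; rewrite expr1; apply: sub_ideal_gen; exists p.
  case/negP; rewrite (mmap_phiN iota p xT).
  (* The images of [fs] vanish at [T] because [fs] vanishes at [x]; so does the power of [phiN N p]
     that they generate. *)
  have /eqP : mmap iota T (phiN N p ^+ k) = 0.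
    apply: (ideal_gen_min (is_ideal_ker (mmap iota T)) _ pk) => _ /mapP[f ffs ->].
    rewrite /= -(mmap_phiN iota f xT); apply: x0; exists 0, f; rewrite add0r.
    split; first by case: (is_ideal_toric K (map_mx Posz N)).
    by split=> //; apply: sub_ideal_gen.
  by rewrite rmorphXn expf_eq0 => /andP[].
- case=> k [a [b [/HNM Ma [Jb pE]]]]; apply: (toric_ideal_radical (k := k)).
  have [_ MD _] := is_ideal_toric K M.
  rewrite pE; apply: MD => //.
  exact: ideal_gen_min (is_ideal_toric K M) Hfs _ Jb.
Qed.
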